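(* Let $\prec$ be an exposure order on $F$, let $\mathcal{Q}$ be a combinatorially reducing system for a right ideal $I\lneqq\mathcal{A}=K[F]$ with respect to $\prec$, and let $T$ be a Schreier transversal for $I$. Then every $f\in\mathcal{A}$ admits a unique decomposition $$f=\sum_{q\in\mathcal{Q}}q\,g_q+r,$$ with $g_q\in\mathcal{A}$ (only finitely many nonzero) and $r\in\mathcal{A}$, where $r$ is supported on $T$ and each $g_q$ is supported on words such that there is no cancellation in the product $\mathrm{HT}_{\prec}(q)\cdot g_q$ (i.e. no word in $\mathrm{supp}(g_q)$ begins with the inverse of the last letter of $\mathrm{HT}_\prec(q)$).
   Context: $K$ is a field, $F$ is a free group with finite basis $S$ (elements are reduced words in $S\cup S^{-1}$; $e$ is the identity), and $\mathcal{A}=K[F]$. The support $\mathrm{supp}(f)$ of $f\in\mathcal{A}$ is the set of words with nonzero coefficient in $f$; $f$ is supported on $T\subseteq F$ if $\mathrm{supp}(f)\subseteq T$. $\mathrm{Sp}_K(T)$ is the $K$-span of $T$. An exposure order on $F$ is a well-order $\prec$ on $F$ such that $u\preceq v$ whenever $u$ is a prefix of $v$. For $0\neq f\in\mathcal{A}$, the head term $\mathrm{HT}(f)=\mathrm{HT}_\prec(f)$ is the $\prec$-maximal word in $\mathrm{supp}(f)$; $f$ is monic if the coefficient of $\mathrm{HT}(f)$ in $f$ is $1$. For $f\in\mathcal{A}\setminus K$, the head term tail $\mathrm{HTT}(f)\in S\cup S^{-1}$ is the last letter of the reduced word $\mathrm{HT}(f)$. A Schreier transversal for $I$ is a prefix-closed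 subset $T\subseteq F$ such that $\mathrm{Sp}_K(T)\cap I=\{0\}$ and every $I$-coset in $\mathcal{A}$ intersects $\mathrm{Sp}_K(T)$. A prefix-neighbor of a prefix-closed set $T$ is a word not in $T$ all of whose proper prefixes lie in $T$; $\partial T$ is the set of prefix-neighbors of $T$. For a set $\mathcal{Q}$ of monic elements of $\mathcal{A}\setminus K$, let $T_{\mathcal{Q}}^{\mathrm{HT}}$ be the set of words in $F$ that do not have any $\mathrm{HT}(q)$, $q\in\mathcal{Q}$, as a prefix. $\mathcal{Q}$ is a combinatorially reducing system (CRS) with respect to $\prec$ if: (1) the head terms $(\mathrm{HT}(q))_{q\in\mathcal{Q}}$ are distinct; (2) for each $q\in\mathcal{Q}$, letting $b=\mathrm{HTT}(q)$, the element $qb^{-1}$ is a $K$-linear combination of elements $h\in\mathcal{Q}$ with $\mathrm{HTT}(h)=b^{-1}$; (3) each $q\in\mathcal{Q}$ is supported on $T_{\mathcal{Q}}^{\mathrm{HT}}\cup\partial T_{\mathcal{Q}}^{\mathrm{HT}}$. It is a CRS for $I$ if moreover it generates $I$ as a right ideal. *)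

(* Defs.v *)
From HB Require Import structures.
From mathcomp Require Import all_boot all_order all_algebra.
From mathcomp Require Import finmap.
From mathcomp Require Import boolp classical_sets wochoice.
From mathcomp.multinomials Require Import monalg.

Set Implicit Arguments.
Unset Strict Implicit.
Unset Printing Implicit Defensive.

Import GRing.Theory.

Local Open Scope classical_set_scope.
Local Open Scope ring_scope.

(* (s, true) stands for the generator s and (s, false) for its inverse. *)
Notation letter S := (S * bool)%type.

Section FreeGroup.
Variable S : finType.
Implicit Types (a b : letter S) (w : seq (letter S)).

Definition linv a : letter S := (a.1, ~~ a.2).

Lemma linvK : involutive linv.
Proof. by case=> s b; rewrite /linv /= negbK. Qed.

Definition reduced w := sorted (fun a b => b != linv a) w.

Record fgroup : predArgType :=
  FWord { fword :> seq (letter S); fwordP : reduced fword }.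

HB.instance Definition _ := [isSub for fword].
HB.instance Definition _ := [Choice of fgroup by <:].

(* Left multiplication of a reduced word by a letter, with cancellation. *)
Definition lmulw a w :=
  if w is b :: w' then if b == linv a then w' else a :: w else [:: a].

Definition mulw (u w : seq (letter S)) := foldr lmulw w u.

Definition invw w := rev (map linv w).

Lemma lmulw_reduced a w : reduced w -> reduced (lmulw a w).
Proof.
rewrite /reduced; case: w => [|b w] //= rw.
case: ifPn => [_|ba] /=; last exact/andP.
exact: path_sorted rw.
Qed.

Lemma mulw_reduced u w : reduced w -> reduced (mulw u w).
Proof. by elim: u => //= a u IHu /IHu; apply: lmulw_reduced. Qed.

Lemma invw_reduced w : reduced w -> reduced (invw w).
Proof.
rewrite /reduced /invw rev_sorted sorted_map; apply: sub_sorted => a b /=.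
by apply: contra_neq; rewrite linvK => ->.
Qed.

Lemma lmulwK a w : reduced w -> lmulw (linv a) (lmulw a w) = w.
Proof.
case: w => [|b w] /=; first by rewrite linvK eqxx.
case: eqP => [-> {b}|_ _] /=; last by rewrite linvK eqxx.
by case: w => [|b w] //= /andP[/negPf-> _].
Qed.

Lemma lmulwVK a w : reduced w -> lmulw a (lmulw (linv a) w) = w.
Proof. by move=> /(lmulwK (linv a)); rewrite linvK. Qed.

Lemma mulw_lmulw a u w : reduced u -> reduced w ->
  mulw (lmulw a u) w = lmulw a (mulw u w).
Proof.
case: u => [|b u] //= ru rw; case: eqP => [->|_] //=.
by rewrite lmulwVK // mulw_reduced.
Qed.

Lemma mulwA u v w : reduced v -> reduced w ->
  mulw u (mulw v w) = mulw (mulw u v) w.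
Proof.
by move=> rv rw; elim: u => //= a u ->; rewrite mulw_lmulw // mulw_reduced.
Qed.

Lemma mulw0 w : reduced w -> mulw w [::] = w.
Proof.
elim: w => //= a w IHw raw; rewrite IHw; last exact: path_sorted raw.
by case: w raw {IHw} => //= b w /andP[/negPf-> _].
Qed.

Lemma mulVw w : reduced w -> mulw (invw w) w = [::].
Proof.
elim: w => //= a w IHw raw; rewrite /invw /= rev_cons /mulw foldr_rcons /=.
by rewrite linvK eqxx; apply: IHw (path_sorted raw).
Qed.

Lemma invwK : involutive invw.
Proof.
by move=> w; rewrite /invw map_rev revK -map_comp (eq_map linvK) map_id.
Qed.

Definition fmul (u v : fgroup) : fgroup := FWord (mulw_reduced u (fwordP v)).
Definition fone : fgroup := @FWord [::] isT.
Definition finv (u : fgroup) : fgroup := FWord (invw_reduced (fwordP u)).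

Lemma fmulA : associative fmul.
Proof. by move=> u v w; apply/val_inj; rewrite /= mulwA ?fwordP. Qed.

Lemma fmul1 : left_id fone fmul.
Proof. by move=> u; apply/val_inj. Qed.

Lemma fmulr1 : right_id fone fmul.
Proof. by move=> u; apply/val_inj; rewrite /= mulw0 ?fwordP. Qed.

Lemma fmulV : left_inverse fone finv fmul.
Proof. by move=> u; apply/val_inj; rewrite /= mulVw ?fwordP. Qed.

Lemma fmulVr : right_inverse fone finv fmul.
Proof.
by move=> u; apply/val_inj; rewrite /= -{1}[fword u]invwK mulVw // invw_reduced
  ?fwordP.
Qed.

HB.instance Definition _ := isGroup.Build fgroup
  fmulA fmul1 fmulr1 fmulV fmulVr.

Definition of_letter b : fgroup := @FWord [:: b] isT.

Definition first_letter (u : fgroup) : option (letter S) := ohead (fword u).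
Definition last_letter (u : fgroup) : option (letter S) :=
  ohead (rev (fword u)).

Definition no_cancellation (u v : fgroup) : Prop :=
  forall b, last_letter u = Some b -> first_letter v <> Some (linv b).

Lemma no_cancellationP (u v : fgroup) :
  no_cancellation u v <-> fword (u * v)%g = fword u ++ fword v.
Proof.
case: u v => [u ru] [v rv]; rewrite /no_cancellation /last_letter /first_letter.
rewrite [fword _]/=; split => [|uv b] /=.
  elim: u ru => //= a [|a' u] IHu raw.
    by case: v {rv IHu} => //= c v /(_ a erefl); case: eqP => // -> /(_ erefl).
  move=> nc; have /andP[/negPf aa' ra'] := raw.
  rewrite -/(mulw (a' :: u) v) IHu //= ?aa' // => b hb; apply: nc.
  by move: hb; rewrite !rev_cons; case: (rev u).
have := mulw_reduced u rv; rewrite (uv : mulw u v = u ++ v).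
case/lastP: u {ru uv} => // u c; rewrite rev_rcons /= => + [cb].
case: v {rv} => //= d v /[swap] -[->]; rewrite cat_rcons cb.
by elim: u => [|x [|y u] IHu] /=; rewrite ?eqxx ?andbF //= => /andP[_ /IHu].
Qed.

Definition word_prefix (u v : fgroup) : bool := prefix (fword u) (fword v).

Definition prefix_closed (T : set fgroup) : Prop :=
  forall u v, word_prefix u v -> T v -> T u.

Definition prefix_neighbors (T : set fgroup) : set fgroup :=
  [set w | ~ T w /\ forall u, word_prefix u w -> u <> w -> T u].

Definition exposure_order (le : rel fgroup) : Prop :=
  well_order le /\ forall u v, word_prefix u v -> le u v.

End FreeGroup.

(* The library only makes {malg K[G]} a ring when G has no nontrivial
   invertible element, hence this alias carrying the convolution product. *)
Definition group_algebra (K : fieldType) (G : groupType) : Type := {malg K[G]}.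

Section GroupAlgebra.
Variables (K : fieldType) (G : groupType).
Local Notation A := (group_algebra K G).

HB.instance Definition _ := GRing.Lmodule.on A.

Implicit Types (f g h : A) (u v : G) (c d : K).

Definition ga_monomial c u : A := << c *g u >>.
Definition ga_one : A := ga_monomial 1 1%g.
Definition ga_mul f g : A :=
  \sum_(u <- msupp f) \sum_(v <- msupp g) ga_monomial (f@_u * g@_v) (u * v)%g.

Lemma ga_monomial0 u : ga_monomial 0 u = 0.
Proof. exact: monalgU0. Qed.

Lemma ga_monomialD c d u :
  ga_monomial (c + d) u = ga_monomial c u + ga_monomial d u.
Proof. exact: monalgUD. Qed.

Lemma ga_monomialE f : f = \sum_(u <- msupp f) ga_monomial f@_u u.
Proof. exact: monalgE. Qed.

Lemma ga_mulEw (X Y : {fset G}) f g : (msupp f `<=` X)%fset ->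
  (msupp g `<=` Y)%fset ->
  ga_mul f g = \sum_(u <- X) \sum_(v <- Y) ga_monomial (f@_u * g@_v) (u * v)%g.
Proof.
move=> fX gY; rewrite /ga_mul (big_fset_incl _ fX) /=.
  apply/eq_bigr=> u _; apply/big_fset_incl => // v _ /mcoeff_outdom ->.
  by rewrite mulr0 ga_monomial0.
move=> u _ /mcoeff_outdom fu.
by rewrite big1 => // v _; rewrite fu mul0r ga_monomial0.
Qed.

Lemma ga_mulDl : left_distributive ga_mul +%R.
Proof.
move=> f g h; have hh := fsubset_refl (msupp h).
rewrite (ga_mulEw (msuppD_le f g) hh) (ga_mulEw (fsubsetUl _ (msupp g)) hh).
rewrite (ga_mulEw (fsubsetUr (msupp f) _) hh) -big_split; apply/eq_bigr=> u _.
rewrite -big_split; apply/eq_bigr=> v _.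
by rewrite /= mcoeffD mulrDl ga_monomialD.
Qed.

Lemma ga_mulDr : right_distributive ga_mul +%R.
Proof.
move=> h f g; have hh := fsubset_refl (msupp h).
rewrite (ga_mulEw hh (msuppD_le f g)) (ga_mulEw hh (fsubsetUl _ (msupp g))).
rewrite (ga_mulEw hh (fsubsetUr (msupp f) _)) -big_split; apply/eq_bigr=> u _.
rewrite -big_split; apply/eq_bigr=> v _.
by rewrite /= mcoeffD mulrDr ga_monomialD.
Qed.

Lemma ga_mulUU c d u v :
  ga_mul (ga_monomial c u) (ga_monomial d v) = ga_monomial (c * d) (u * v)%g.
Proof.
by rewrite (ga_mulEw (@msuppU_le _ _ u c) (@msuppU_le _ _ v d)) !big_seq_fset1
  !mcoeffUU.
Qed.

Lemma ga_mul0l : left_zero 0 ga_mul.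
Proof. by move=> f; apply: (addrI (ga_mul 0 f)); rewrite -ga_mulDl !addr0. Qed.

Lemma ga_mul0r : right_zero 0 ga_mul.
Proof. by move=> f; apply: (addrI (ga_mul f 0)); rewrite -ga_mulDr !addr0. Qed.

Lemma ga_mul_suml (I : Type) (r : seq I) (F : I -> A) g :
  ga_mul (\sum_(i <- r) F i) g = \sum_(i <- r) ga_mul (F i) g.
Proof. exact: (big_morph (ga_mul^~ g) (fun _ _ => ga_mulDl _ _ _) (ga_mul0l g)). Qed.

Lemma ga_mul_sumr (I : Type) (r : seq I) (F : I -> A) g :
  ga_mul g (\sum_(i <- r) F i) = \sum_(i <- r) ga_mul g (F i).
Proof. exact: (big_morph (ga_mul g) (fun _ _ => ga_mulDr _ _ _) (ga_mul0r g)). Qed.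

Lemma ga_mulA : associative ga_mul.
Proof.
move=> f g h; rewrite (ga_monomialE f) !ga_mul_suml; apply: eq_bigr => u _.
rewrite (ga_monomialE g) ga_mul_suml !ga_mul_sumr ga_mul_suml.
apply: eq_bigr => v _; rewrite (ga_monomialE h) !ga_mul_sumr.
by apply: eq_bigr => w _; rewrite !ga_mulUU mulrA mulgA.
Qed.

Lemma ga_mul1l : left_id ga_one ga_mul.
Proof.
move=> f; rewrite {1}(ga_monomialE f) ga_mul_sumr [RHS]ga_monomialE.
by apply: eq_bigr => u _; rewrite ga_mulUU mul1r mul1g.
Qed.

Lemma ga_mul1r : right_id ga_one ga_mul.
Proof.
move=> f; rewrite {1}(ga_monomialE f) ga_mul_suml [RHS]ga_monomialE.
by apply: eq_bigr => u _; rewrite ga_mulUU mulr1 mulg1.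
Qed.

Lemma ga_one_neq0 : ga_one != 0.
Proof.
by apply/eqP/malgP => /(_ 1%g)/eqP; rewrite mcoeffUU mcoeff0 oner_eq0.
Qed.

HB.instance Definition _ := GRing.Zmodule_isNzRing.Build A
  ga_mulA ga_mul1l ga_mul1r ga_mulDl ga_mulDr ga_one_neq0.

Lemma ga_scaleE c f : c *: f = ga_monomial c 1%g * f.
Proof.
rewrite {2}(ga_monomialE f) /GRing.mul /= ga_mul_sumr.
rewrite {1}(ga_monomialE f) scaler_sumr; apply: eq_bigr => u _.
rewrite ga_mulUU mul1g; apply/malgP => v.
by rewrite mcoeffZ !mcoeffU mulrnAr.
Qed.

Lemma ga_scaleAl c f g : c *: (f * g) = (c *: f) * g.
Proof. by rewrite !ga_scaleE mulrA. Qed.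

HB.instance Definition _ := GRing.Lmodule_isLalgebra.Build K A ga_scaleAl.

Lemma ga_scaleAr c f g : c *: (f * g) = f * (c *: g).
Proof.
suff cC : ga_monomial c 1%g * f = f * ga_monomial c 1%g.
  by rewrite !ga_scaleE mulrA cC mulrA.
rewrite (ga_monomialE f) mulr_sumr mulr_suml; apply: eq_bigr => u _.
by rewrite /GRing.mul /= !ga_mulUU mul1g mulg1 mulrC.
Qed.

HB.instance Definition _ := GRing.Lalgebra_isAlgebra.Build K A ga_scaleAr.

Definition ga_word u : A := ga_monomial 1 u.

Definition supp f : set G := [set u | u \in msupp f].

End GroupAlgebra.

Definition linear_span (K : fieldType) (V : lmodType K) (X : set V) : set V :=
  [set v | exists (s : seq V) (c : V -> K),
    (forall x, x \in s -> X x) /\ v = \sum_(x <- s) c x *: x].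

Definition right_ideal (R : nzRingType) (I : set R) : Prop :=
  [/\ I 0, forall x y, I x -> I y -> I (x + y) & forall x a, I x -> I (x * a)].

Section Transversals.
Variables (K : fieldType) (S : finType).
Local Notation F := (fgroup S).
Local Notation A := (group_algebra K F).
Implicit Types (le : rel F) (f q h : A) (T : set F) (Q I : set A).

Definition Sp T : set A := linear_span [set ga_word K u | u in T].

(* HT is meant for f <> 0 (its value at 0 is the identity). *)
Definition HT le f : F :=
  head 1%g [seq u <- msupp f | all (fun v => le v u) (msupp f)].

Definition monic le f : Prop := f@_(HT le f) = 1.

Definition is_scalar f : Prop := exists c : K, f = c%:A.

(* HTT is meant for f outside K, for which HT le f is a nonempty word. *)
Definition HTT le f : option (letter S) := last_letter (HT le f).

Definition schreier_transversal I T : Prop :=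
  [/\ prefix_closed T,
      Sp T `&` I = [set 0] &
      forall f, [set f + x | x in I] `&` Sp T !=set0].

Definition T_HT le Q : set F :=
  [set w | forall q, Q q -> ~~ word_prefix (HT le q) w].

Definition CRS le Q : Prop :=
  [/\ forall q, Q q -> monic le q /\ ~ is_scalar q,
      forall q h, Q q -> Q h -> HT le q = HT le h -> q = h,
      forall q b, Q q -> HTT le q = Some b ->
        linear_span [set h | Q h /\ HTT le h = Some (linv b)]
          (q * ga_word K (of_letter b)^-1%g) &
      forall q, Q q -> supp q `<=` T_HT le Q `|` prefix_neighbors (T_HT le Q)].

Definition CRS_for le I Q : Prop :=
  CRS le Q /\ I = smallest (@right_ideal A) Q.

End Transversals.

(* Main.v *)
(** Existence: the sums of products q * g_q without cancellation already form a
right ideal, because a product q * w whose first letter b^-1 cancels can be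
rewritten, using q b^-1 = sum of c_h h with HTT h = b^-1, into products h * w'
that do not cancel, w' being w without its first letter.

Uniqueness: suppose a sum of products q * g_q without cancellation vanishes.
Take w of maximal length in the supports of the g_q, and then q0 with w in
supp g_q0 and with maximal head term. If u * v = HT(q0) w for some u in supp q
and v in supp g_q, then |v| <= |w| forces HT(q0) to be a prefix of u; as all
proper prefixes of u avoid the head terms, u = HT(q0) and v = w, and the choice
of q0 gives q = q0. Hence the coefficient of HT(q0) w in the sum is nonzero. *)

Require Import Defs.
From HB Require Import structures.
From mathcomp Require Import all_boot all_order all_algebra.
From mathcomp Require Import finmap.
From mathcomp Require Import boolp classical_sets wochoice.
From mathcomp.multinomials Require Import monalg.

Set Implicit Arguments.
Unset Strict Implicit.
Unset Printing Implicit Defensive.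

Import GRing.Theory.

Local Open Scope classical_set_scope.
Local Open Scope ring_scope.

(** * Finite maxima and well-orders *)

Lemma max_in_seq (X : eqType) (r : rel X) (s : seq X) :
  total r -> transitive r -> s != [::] ->
  exists2 x, x \in s & {in s, forall y, r y x}.
Proof.
move=> rT rtr; elim: s => // a s IHs _.
have [->|/IHs[x xs xmax]] := eqVneq s [::].
  exists a => [|y]; rewrite ?mem_head // inE => /eqP->.
  by have := rT a a; rewrite orbb.
have /orP[ax|xa] := rT a x.
  by exists x => [|y]; rewrite inE ?xs ?orbT // => /orP[/eqP->|/xmax].
exists a => [|y]; rewrite ?mem_head // inE => /orP[/eqP->|/xmax yx].
  by have := rT a a; rewrite orbb.
exact: rtr yx xa.
Qed.

(** Transitivity comes from the least element of {x, y, z}: if it is [y] or [z], antisymmetry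
    identifies two consecutive terms of the chain. *)
Lemma well_order_total_order (X : eqType) (r : rel X) :
  well_order r -> total_order r.
Proof.
move=> wo; have wor : wo_chain r predT by apply: withinW.
have tot : total r by move=> x y; apply: (wo_chainW wor).
have anti : antisymmetric r.
  by move=> x y; apply: (wo_chain_antisymmetric wor).
have refl : reflexive r by move=> x; have := tot x x; rewrite orbb.
split=> //; split=> //; split=> // y x z xy yz.
have [|m [[]]] := wo (pred3 x y z); first by exists x; rewrite !inE eqxx.
rewrite !inE => /or3P[]/eqP-> mmin _.
- by apply: mmin; rewrite !inE eqxx !orbT.
- suff -> : x = y by [].
  by apply: anti; rewrite xy mmin // !inE eqxx.
- suff -> : z = y by [].
  by apply: anti; rewrite yz mmin // !inE eqxx orbT.
Qed.

(** * Cancellation in products of reduced words *)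

Section Words.
Variable S : finType.
Implicit Types (a b : letter S) (u v w : fgroup S).

(** The letter [a] cannot cancel against a nonempty [u1], since [a :: u] is reduced; with [u1]
    empty, it either survives or shortens [v1]. *)
Lemma mulw_split (u v : seq (letter S)) : reduced u ->
  exists u1 v1 : seq (letter S),
    [/\ mulw u v = u1 ++ v1, prefix u1 u & size v1 <= size v]%N.
Proof.
elim: u => [|a u IHu] rau; first by exists [::], v.
have [u1 [v1 [/= -> u1u v1v]]] := IHu (path_sorted rau).
case: u1 u1u => [|b u1] u1u /=.
  case: v1 v1v => [|c v1] /= v1v.
    by exists [:: a], [::]; rewrite /= eqxx prefix0s.
  case: ifP => _; first by exists [::], v1; split=> //; apply: ltnW.
  by exists [:: a], (c :: v1); rewrite /= eqxx prefix0s.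
have ba : b != linv a.
  case: u u1u rau {IHu} => //= c u /andP[/eqP-> _].
  by case/andP.
rewrite (negPf ba); exists [:: a, b & u1], v1; split=> //.
by rewrite /= eqxx.
Qed.

(** Beyond the surviving prefix of [u], the product has at most [size v] letters, so [p] fits inside
    that prefix. *)
Lemma fmul_long_tail_prefix (u v p w : fgroup S) :
  fword (u * v)%g = fword p ++ fword w -> (size v <= size w)%N ->
  word_prefix p u.
Proof.
have [u1 [v1 [uv u1u v1v]]] := mulw_split v (fwordP u).
rewrite [LHS]uv => eq_uv vw; apply: prefix_trans u1u.
have le_pu1 : (size p <= size u1)%N.
  have /eqP := congr1 size eq_uv; rewrite !size_cat => /eqP eq_sz.
  by rewrite -(leq_add2r (size w)) -eq_sz leq_add2l (leq_trans v1v).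
have := congr1 (take (size p)) eq_uv.
by rewrite takel_cat // take_size_cat // => <-; apply: prefix_take.
Qed.

(** As [w] is reduced, [w'] does not begin with [b], hence will not cancel against a word ending in
    the inverse of [b]. *)
Lemma cancellationP u w : ~ no_cancellation u w ->
  exists b w', [/\ last_letter u = Some b,
                   w = ((of_letter b)^-1 * w')%g &
                   first_letter w' <> Some b].
Proof.
case: w => -[|c w] rw nc; first by case: nc => b _.
have [b ub cb] : exists2 b, last_letter u = Some b & c = linv b.
  apply: contrapT => nex; apply: nc => b ub [cb].
  by apply: nex; exists b.
subst c; exists b, (FWord (path_sorted rw)); split=> //.
  apply: val_inj => /=; have := rw.
  by case: (w) => //= d w' /andP[/negPf->].
have := rw; rewrite /first_letter /reduced /=.
by case: (w) => //= d w' /andP[+ _] -[db]; rewrite db linvK eqxx.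
Qed.

End Words.

(** * Coefficients of products in the group algebra *)

Section GroupAlgebraCoefficients.
Variables (K : fieldType) (G : groupType).
Local Notation A := (group_algebra K G).
Implicit Types (f g : A) (u v : G).

Lemma mcoeff_ga_mul f g v :
  (f * g)@_v = \sum_(u <- msupp f) f@_u * g@_(u^-1 * v)%g.
Proof.
rewrite /GRing.mul /= /ga_mul raddf_sum; apply: eq_bigr => u _ /=.
rewrite -/(GRing.mul _ _) raddf_sum /=.
under eq_bigr => w _ do rewrite mcoeffU.
have [vg|vg] := boolP (u^-1 * v \in msupp g)%g.
  rewrite (big_fsetD1 _ vg) /= mulVKg eqxx mulr1n big1_seq ?addr0 //.
  move=> w /= /fsetD1P[wv _]; case: eqP => // uwv.
  by rewrite -uwv mulKg eqxx in wv.
rewrite (mcoeff_outdom vg) mulr0 big1_seq // => w /= wg.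
by case: eqP => // uwv; rewrite -uwv mulKg wg in vg.
Qed.

Lemma ga_word_expansion f : f = \sum_(u <- msupp f) f@_u *: ga_word K u.
Proof.
rewrite {1}[f]ga_monomialE; apply: eq_bigr => u _; apply/malgP => v.
by rewrite mcoeffZ !mcoeffU mulrnAr mulr1.
Qed.

Lemma ga_wordM u v : ga_word K (u * v)%g = ga_word K u * ga_word K v.
Proof. by rewrite [RHS]ga_mulUU mulr1. Qed.

End GroupAlgebraCoefficients.

Section FiniteCombinations.
Variables (K : fieldType) (G : groupType).
Local Notation A := (group_algebra K G).
Implicit Types (g : {fsfun A -> A with 0}) (X : {fset A}).

(** Brings families with different finite supports to a common index set. *)
Lemma big_finsuppW g X : (finsupp g `<=` X)%fset ->
  \sum_(q <- finsupp g) q * g q = \sum_(q <- X) q * g q.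
Proof.
move=> gX; apply: big_fset_incl => // q _ /fsfun_dflt ->.
by rewrite mulr0.
Qed.

End FiniteCombinations.

(** * Spans of words and head terms *)

Section Decomposition.
Variables (K : fieldType) (S : finType).
Local Notation F := (fgroup S).
Local Notation A := (group_algebra K F).
Implicit Types (le : rel F) (f q h : A) (T : set F) (Q I : set A).

Lemma Sp_supp T f : Sp T f <-> supp f `<=` T.
Proof.
split=> [[s [c [sT ->]]] u|fT]; last first.
  (* [linear_span] indexes coefficients by vectors; at the single word [u] the inner sum reduces to
     [f@_u]. *)
  exists [seq ga_word K u | u <- msupp f], (fun x => \sum_(v <- msupp x) f@_v).
  split=> [x /mapP[u uf ->]|]; first by exists u => //; apply: fT.
  rewrite big_map {1}[f]ga_word_expansion; apply: eq_bigr => u _.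
  by rewrite msuppU oner_eq0 big_seq_fset1.
rewrite /supp /= -mcoeff_neq0 raddf_sum; apply: contra_neqP => nTu.
rewrite big1_seq // => x /= /sT[t Tt <-]; rewrite mcoeffZ mcoeffU.
by case: eqP => [tu|_]; rewrite ?mulr0 // -tu in nTu *.
Qed.

Lemma HT_max le f : total le -> transitive le -> f != 0 ->
  HT le f \in msupp f /\ {in msupp f, forall u, le u (HT le f)}.
Proof.
move=> leT letr f0.
have sf0 : (msupp f : seq F) != [::].
  apply: contra_neq f0 => sf; apply/malgP => u; rewrite mcoeff0.
  by apply: mcoeff_outdom; rewrite -[_ \in _]/(u \in (msupp f : seq F)) sf.
have [x xf xmax] := max_in_seq leT letr sf0.
rewrite /HT; set s := filter _ _.
(* The maximum passes the filter, so [head] does not fall back on its default [1%g]. *)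
have : x \in s by rewrite mem_filter xf andbT; apply/allP => u /xmax.
case E: s => [//|y s'] _; have : y \in s by rewrite E mem_head.
by rewrite mem_filter => /andP[/allP yf].
Qed.

(** * Existence: the right ideal of sums without cancellation *)

Definition decomposable le Q f :=
  exists g : {fsfun A -> A with 0},
    [/\ forall q, q \in finsupp g -> Q q,
        forall q w, Q q -> supp (g q) w -> no_cancellation (HT le q) w &
        f = \sum_(q <- finsupp g) q * g q].

Lemma decomposable0 le Q : decomposable le Q 0.
Proof.
exists [fsfun]; split=> [q|q w _|]; rewrite ?in_finsupp0 //.
  by rewrite fsfun0E /supp /= msupp0 in_fset0.
by rewrite finsupp0 big_seq_fset0.
Qed.

Lemma decomposableD le Q f1 f2 :
  decomposable le Q f1 -> decomposable le Q f2 -> decomposable le Q (f1 + f2).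
Proof.
move=> [g1 [g1Q g1nc ->]] [g2 [g2Q g2nc ->]].
pose X := (finsupp g1 `|` finsupp g2)%fset.
pose g := [fsfun q in X => g1 q + g2 q] : {fsfun A -> A with 0}.
have gE q : g q = g1 q + g2 q.
  rewrite fsfun_fun; case: ifPn => //; rewrite in_fsetU negb_or => /andP[q1 q2].
  by rewrite !fsfun_dflt ?addr0.
have gX : (finsupp g `<=` X)%fset by apply: finsupp_sub.
exists g; split=> [q /(fsubsetP gX)|q w Qq|].
- by rewrite in_fsetU => /orP[/g1Q|/g2Q].
- rewrite gE /supp /= => /(fsubsetP (msuppD_le _ _)); rewrite in_fsetU.
  by case/orP; [apply: g1nc|apply: g2nc].
- rewrite (big_finsuppW gX) (big_finsuppW (fsubsetUl _ _ : _ `<=` X)%fset).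
  rewrite (big_finsuppW (fsubsetUr _ _ : _ `<=` X)%fset) -big_split /=.
  by apply: eq_bigr => q _; rewrite gE mulrDr.
Qed.

Lemma decomposableZ le Q c f : decomposable le Q f -> decomposable le Q (c *: f).
Proof.
move=> [g [gQ gnc ->]].
pose h := [fsfun q in finsupp g => c *: g q] : {fsfun A -> A with 0}.
have hE q : h q = c *: g q.
  by rewrite fsfun_fun; case: ifPn => // /fsfun_dflt->; rewrite scaler0.
have hg : (finsupp h `<=` finsupp g)%fset by apply: finsupp_sub.
exists h; split=> [q /(fsubsetP hg)/gQ//|q w Qq|].
  by rewrite hE => /(fsubsetP (msuppZ_le _ _)); apply: gnc.
rewrite (big_finsuppW hg) scaler_sumr; apply: eq_bigr => q _.
by rewrite hE scalerAr.
Qed.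

Lemma decomposable_sum le Q (X : Type) (s : seq X) (P : pred X) (f : X -> A) :
  (forall x, P x -> decomposable le Q (f x)) ->
  decomposable le Q (\sum_(x <- s | P x) f x).
Proof.
move=> fP; apply: big_ind => //; first exact: decomposable0.
by move=> ? ?; apply: decomposableD.
Qed.

Lemma decomposable_no_cancellation le Q q w :
  Q q -> no_cancellation (HT le q) w -> decomposable le Q (q * ga_word K w).
Proof.
move=> Qq nc.
pose g := [fsfun h in [fset q]%fset => ga_word K w] : {fsfun A -> A with 0}.
have gq : (finsupp g `<=` [fset q])%fset by apply: finsupp_sub.
exists g; split=> [h /(fsubsetP gq)|h v Qh|].
- by rewrite inE => /eqP->.
- rewrite fsfun_fun inE; case: eqP => [->|_]; last by rewrite /supp /= msupp0.
  by rewrite /supp /= msuppU oner_eq0 inE => /eqP->.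
- by rewrite (big_finsuppW gq) big_seq_fset1 fsfun_fun inE eqxx.
Qed.

(** One rewriting suffices, without recursion on [w]: every new head term ends in the inverse of
    [b], while [w'] does not begin with [b]. *)
Lemma decomposable_mul_word le Q q w :
  CRS le Q -> Q q -> decomposable le Q (q * ga_word K w).
Proof.
move=> [_ _ Qtail _] Qq.
have [|/cancellationP[b [w' [qb -> w'b]]]] :=
  pselect (no_cancellation (HT le q) w).
  exact: decomposable_no_cancellation.
have [s [c [sQ qE]]] := Qtail _ _ Qq qb.
rewrite ga_wordM mulrA qE mulr_suml big_seq.
apply: decomposable_sum => h /sQ[Qh hb].
rewrite -scalerAl; apply/decomposableZ/decomposable_no_cancellation => // d.
by rewrite -/(HTT le h) hb => -[<-]; rewrite linvK.
Qed.

Lemma decomposable_mul_CRS le Q q f :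
  CRS le Q -> Q q -> decomposable le Q (q * f).
Proof.
move=> QC Qq; rewrite [f]ga_word_expansion mulr_sumr; apply: decomposable_sum => w _.
by rewrite -scalerAr; apply/decomposableZ/decomposable_mul_word.
Qed.

Lemma decomposable_right_ideal le Q :
  CRS le Q -> right_ideal (decomposable le Q).
Proof.
move=> QC; split=> [|f1 f2|f a [g [gQ _ ->]]]; first exact: decomposable0.
  exact: decomposableD.
rewrite mulr_suml big_seq; apply: decomposable_sum => q /gQ Qq.
by rewrite -mulrA; apply: decomposable_mul_CRS.
Qed.

Lemma decomposable_generated le Q :
  CRS le Q -> smallest (@right_ideal A) Q `<=` decomposable le Q.
Proof.
move=> QC; apply: smallest_sub; first exact: decomposable_right_ideal.
by move=> q Qq; rewrite -[q]mulr1; apply: decomposable_mul_CRS.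
Qed.

(** * Uniqueness: independence of the products without cancellation *)

Lemma CRS_supp_prefix_HT le Q q h u :
  CRS le Q -> Q q -> Q h -> u \in msupp h -> word_prefix (HT le q) u ->
  HT le q = u.
Proof.
move=> [_ _ _ Qsupp] Qq Qh /(Qsupp _ Qh)[uT|[_ uT]] qu.
  by have := uT _ Qq; rewrite qu.
(* Here [u] is a prefix-neighbor: as a proper prefix, [HT le q] would lie in [T_HT le Q], yet it has
   itself as a prefix. *)
apply: contrapT => neq_qu; have := uT _ qu neq_qu _ Qq.
by rewrite /word_prefix prefix_refl.
Qed.

(* An exposure order is not compatible with right multiplication, so HT le q * w
   need not be the head term of q * w: the surviving coefficient is located by
   first maximizing the length of w, and only then the head term of q. *)
Lemma CRS_independent le Q (X : {fset A}) (d : A -> A) :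
  exposure_order le -> CRS le Q -> (forall q, q \in X -> Q q) ->
  (forall q w, q \in X -> supp (d q) w -> no_cancellation (HT le q) w) ->
  \sum_(q <- X) q * d q = 0 -> forall q, q \in X -> d q = 0.
Proof.
move=> [/well_order_total_order[[[_ letr] leanti] leT] _] QC XQ Xnc sum0 q1 q1X.
have HTin q : Q q -> HT le q \in msupp q.
  by case: QC => /(_ q)QC _ _ _ /QC[qm _]; rewrite -mcoeff_neq0 qm oner_eq0.
apply: contrapT => /eqP dq1.
have [w] : exists2 w, w \in flatten [seq (msupp (d q) : seq F) | q <- X] &
    forall q v, q \in X -> v \in msupp (d q) -> (size v <= size w)%N.
  pose r := relpre (size : F -> nat) leq.
  have rT : total r by move=> x y; apply: leq_total.
  have rtr : transitive r by move=> y x z; apply: leq_trans.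
  have [|w ws wmax] := @max_in_seq _ r
      (flatten [seq (msupp (d q) : seq F) | q <- X]) rT rtr.
    suff: HT le (d q1) \in flatten [seq (msupp (d q) : seq F) | q <- X].
      by case: flatten.
    by apply/flatten_mapP; exists q1 => //; have [] := HT_max leT letr dq1.
  exists w => // q v qX vq; apply: wmax.
  by apply/flatten_mapP; exists q.
case/flatten_mapP=> q2 q2X wq2 wmax.
have [q0 [q0X wq0] q0max] : exists2 q0, q0 \in X /\ w \in msupp (d q0) &
    forall q, q \in X -> w \in msupp (d q) -> le (HT le q) (HT le q0).
  pose r := relpre (HT le : A -> F) le.
  have rT : total r by move=> x y; apply: leT.
  have rtr : transitive r by move=> y x z; apply: letr.
  have [|q0] := @max_in_seq _ r [seq q <- X | w \in msupp (d q)] rT rtr.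
    have: q2 \in [seq q <- X | w \in msupp (d q)] by rewrite mem_filter wq2.
    by case: filter.
  rewrite mem_filter => /andP[wq0 q0X] q0max; exists q0 => // q qX wq.
  by apply: q0max; rewrite mem_filter wq.
have q0w : fword (HT le q0 * w)%g = fword (HT le q0) ++ fword w.
  exact/no_cancellationP/Xnc.
(* Only the pair formed by [q0] and its head term contributes to the coefficient of
   [HT le q0 * w]. *)
have isolated q u : q \in X -> u \in msupp q ->
    (u^-1 * (HT le q0 * w))%g \in msupp (d q) -> q = q0 /\ u = HT le q0.
  set v := (u^-1 * _)%g => qX uq vq.
  have uv : (u * v = HT le q0 * w)%g by rewrite mulVKg.
  have u0 : HT le q0 = u.
    apply: (CRS_supp_prefix_HT QC (XQ _ q0X) (XQ _ qX) uq).
    apply: (@fmul_long_tail_prefix _ u v _ w); first by rewrite uv.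
    exact: wmax vq.
  have vw : v = w by rewrite /v u0 mulKg.
  split=> //; case: (QC) => _ HTinj _ _; apply: HTinj; [exact: XQ|exact: XQ|].
  (* One inequality is the choice of [q0], as [w] occurs in [d q]; the other holds because
     [HT le q0 = u] occurs in [q]. *)
  apply: leanti; rewrite q0max -?vw // u0.
  have [|_ ->//] := @HT_max le q leT letr.
  by apply: contraTneq uq => ->; rewrite msupp0 in_fset0.
(* Since [q0] is monic, this coefficient is that of [w] in [d q0], which is nonzero. *)
have := congr1 (mcoeff (HT le q0 * w)%g) sum0.
rewrite mcoeff0 raddf_sum /= (big_fsetD1 _ q0X) /= [X in _ + X]big1_seq ?addr0.
  rewrite mcoeff_ga_mul (big_fsetD1 _ (HTin _ (XQ _ q0X))) /= mulKg.
  rewrite big1_seq ?addr0.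
    case: (QC) => /(_ _ (XQ _ q0X))[-> _] _ _ _; rewrite mul1r => /eqP.
    by rewrite mcoeff_eq0 wq0.
  move=> u /= /fsetD1P[uq0 uq]; rewrite [X in _ * X]mcoeff_outdom ?mulr0 //.
  by apply: contra_neqN uq0 => /(isolated _ _ q0X uq)[].
move=> q /= /fsetD1P[qq0 qX]; rewrite mcoeff_ga_mul big1_seq // => u /= uq.
rewrite [X in _ * X]mcoeff_outdom ?mulr0 //.
by apply: contra_neqN qq0 => /(isolated _ _ qX uq)[].
Qed.

End Decomposition.

Theorem theorem1p4 (K : fieldType) (S : finType) (le : rel (fgroup S))
    (I Q : set (group_algebra K (fgroup S))) (T : set (fgroup S)) :
  exposure_order le ->
  right_ideal I -> I `<` [set: group_algebra K (fgroup S)] ->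
  CRS_for le I Q ->
  schreier_transversal I T ->
  forall f : group_algebra K (fgroup S),
  exists! gr : {fsfun group_algebra K (fgroup S) ->
                      group_algebra K (fgroup S) with 0}
               * group_algebra K (fgroup S),
    [/\ forall q, q \in finsupp gr.1 -> Q q,
        supp gr.2 `<=` T,
        forall q w, Q q -> supp (gr.1 q) w -> no_cancellation (HT le q) w &
        f = \sum_(q <- finsupp gr.1) q * gr.1 q + gr.2].
Proof.
move=> le_exp Iri _ [QC IE] [_ TI0 Tcos] f.
have QI q g : Q q -> I (q * g).
  by case: Iri => _ _ IM Qq; apply: IM; rewrite IE => J [_ QJ]; apply: QJ.
have [r [[x Ix fxr] /Sp_supp rT]] := Tcos f.
(* The coset representative satisfies [f + x = r], so the part of [f] in [I] is [- x]. *)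
have [g [gQ gnc xg]] : decomposable le Q (- x).
  apply: (decomposable_generated QC); rewrite -IE -[x]mulr1 -mulrN.
  by case: Iri => _ _; apply.
have fE : f = \sum_(q <- finsupp g) q * g q + r.
  by rewrite -xg -fxr addrC addrK.
exists (g, r); split=> [//|[g' r'] /= [g'Q r'T g'nc fE']].
pose X := (finsupp g `|` finsupp g')%fset.
have XQ q : q \in X -> Q q by rewrite in_fsetU => /orP[/gQ|/g'Q].
have sumE : \sum_(q <- X) q * (g q - g' q) = r' - r.
  under eq_bigr do rewrite mulrBr.
  rewrite sumrB -(big_finsuppW (fsubsetUl _ _)) -(big_finsuppW (fsubsetUr _ _)).
  apply/eqP; rewrite subr_eq addrAC eq_sym subr_eq -fE addrC; exact/eqP.
(* The difference is supported on [T], and by [sumE] it lies in [I]; the transversal meets [I] only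
   in 0. *)
have rr' : r' - r = 0.
  suff: (Sp T `&` I) (r' - r) by rewrite TI0.
  split.
    apply/Sp_supp => u /(fsubsetP (msuppB_le _ _)).
    by rewrite in_fsetU => /orP[/r'T|/rT].
  rewrite -sumE big_seq; case: Iri => I0 ID _.
  by apply: big_ind => // q /XQ; apply: QI.
congr pair; last by apply/esym/eqP; rewrite -subr_eq0 rr'.
apply/fsfunP => q; have [qX|] := boolP (q \in X); last first.
  by rewrite in_fsetU negb_or => /andP[? ?]; rewrite !fsfun_dflt.
apply/eqP; rewrite -subr_eq0; apply/eqP.
(* Absence of cancellation passes to [g q - g' q], whose support lies in the union of the two
   supports. *)
apply: (CRS_independent (d := fun q => g q - g' q) le_exp QC XQ _ _ qX).
  move=> h w /XQ Qh /(fsubsetP (msuppB_le _ _)); rewrite in_fsetU.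
  by case/orP; [apply: gnc|apply: g'nc].
by rewrite sumE rr'.
Qed.
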